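(* Let $x(d)$ be the Richardson element of $\mathfrak{p}(d)$ attached to the horizontal line diagram $L_h(d)$. Let $$x=\sum_{\epsilon_i-\epsilon_j\in\Phi^+\setminus\Phi(\mathfrak{m})^+}k_{i,j}e_{i,j}$$ be an element of $\mathfrak{u}$, and let $(a,b)$ be such that $k_{a,b}\neq 0$ and $l(a)\neq l(b)$. If $[x(d),x]=0$, then: (1) If $a^-\neq\emptyset$, then $b^-\neq\emptyset$ and $k_{a^-,b^-}=k_{a,b}$. (2) If $b^+\neq\emptyset$, then $a^+\neq\emptyset$ and $k_{a^+,b^+}=k_{a,b}$. (3) If $a^-=b^+=\emptyset$, then $[x(d),x-k_{a,b}e_{a,b}]=0$.
   Context: $K$ is an algebraically closed field of characteristic $p>0$. A dimension vector is a tuple $d=(d_1,\ldots,d_\ell)$ of positive integers with $\sum_i d_i=n+1$. $\mathfrak{p}(d)=\mathfrak{m}\oplus\mathfrak{u}\subseteq\mathfrak{sl}_{n+1}(K)$ is the standard (block upper-triangular) parabolic subalgebra with diagonal block sizes $d_1,\ldots,d_\ell$, Levi factor $\mathfrak{m}$ and nilradical $\mathfrak{u}$. $\Phi^+=\{\epsilon_i-\epsilon_j\mid 1\le i<j\le n+1\}$ is the set of positive roots and $\Phi(\mathfrak{m})^+$ the set of positive roots of $\mathfrak{m}$, i.e. those $\epsilon_i-\epsilon_j$, $i<j$, with $i,j$ in the same block; $\mathfrak{u}$ has basis the matrix units $e_{i,j}$ with $\epsilon_i-\epsilon_j\in\Phi^+\setminus\Phi(\mathfrak{m})^+$. Horizontal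 line diagram $L_h(d)$: arrange $\ell$ columns of $d_1,\ldots,d_\ell$ dots, top-adjusted; label the dots $1,\ldots,n+1$ column by column from left to right, top to bottom in each column; join each dot by a horizontal line to the next dot to its right in the same row, if there is one (possibly skipping columns having no dot in that row). The Richardson element is $x(d)=\sum e_{i,j}$, summed over all horizontal lines $i - j$ of $L_h(d)$ with $i<j$. For a dot $a$, $l(a)$ is the number of the row (line) in which $a$ lies. $a^+$ denotes the dot joined to $a$ by a horizontal line and lying to its right (its horizontal successor), and $a^-$ the dot joined to $a$ by a horizontal line and lying to its left (its horizontal predecessor); $a^{\pm}=\emptyset$ means that no such dot exists. *)

(* Defs.v *)
From mathcomp Require Import all_boot all_order all_algebra.
Set Implicit Arguments.
Unset Strict Implicit.
Unset Printing Implicit Defensive.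
Import GRing.Theory.
Local Open Scope ring_scope.

Definition dim_vector (n : nat) (d : seq nat) : Prop :=
  all (leq 1) d /\ sumn d = n.+1.

(* Dots, rows, columns and matrix indices are numbered from 0: the label
   i + 1 of the diagram is the ordinal i.  Since labels run down the columns
   from left to right, reshaping 0, ..., n along d puts i in its column (at
   reshape_index) and in its row (at reshape_offset).  The columns are also
   the diagonal blocks of the parabolic subalgebra. *)
Definition dcol (d : seq nat) (i : nat) : nat := reshape_index d i.
Definition drow (d : seq nat) (i : nat) : nat := reshape_offset d i.

(* The roots are given by index pairs: (i, j) stands for eps_i - eps_j. *)
Definition pos_root (n : nat) (i j : 'I_n.+1) : bool := (i < j)%N.

Definition levi_pos_root (n : nat) (d : seq nat) (i j : 'I_n.+1) : bool :=
  (i < j)%N && (dcol d i == dcol d j).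

Definition nilrad_root (n : nat) (d : seq nat) (i j : 'I_n.+1) : bool :=
  pos_root i j && ~~ levi_pos_root d i j.

(* Oriented: i is the left end of the line and j the right end. *)
Definition hline (n : nat) (d : seq nat) (i j : 'I_n.+1) : bool :=
  [&& drow d i == drow d j, (dcol d i < dcol d j)%N &
      [forall k : 'I_n.+1,
         (drow d k == drow d i) ==>
         ~~ ((dcol d i < dcol d k)%N && (dcol d k < dcol d j)%N)]].

(* A dot has at most one line on each side, so [pick] involves no choice. *)
Definition hsucc (n : nat) (d : seq nat) (a : 'I_n.+1) : option 'I_n.+1 :=
  [pick j | hline d a j].

Definition hpred (n : nat) (d : seq nat) (a : 'I_n.+1) : option 'I_n.+1 :=
  [pick i | hline d i a].

Definition richardson (K : fieldType) (n : nat) (d : seq nat) : 'M[K]_n.+1 :=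
  \sum_i \sum_(j | hline d i j && (i < j)%N) delta_mx i j.

Definition lie_bracket (K : fieldType) (n : nat) (A B : 'M[K]_n) : 'M[K]_n :=
  A *m B - B *m A.

(* Main.v *)
Require Import Defs.
From mathcomp Require Import all_boot all_order all_algebra.
Set Implicit Arguments.
Unset Strict Implicit.
Unset Printing Implicit Defensive.
Import GRing.Theory.
Local Open Scope ring_scope.

(** Each dot has at most one horizontal successor and one horizontal
    predecessor, so the Richardson element [R] is a partial permutation matrix.
    Left multiplication by [R] therefore replaces row [i] of a matrix by its
    row [i^+], and right multiplication replaces column [j] by column [j^-]; a
    missing neighbour gives a zero row or column ([mul_richardsonl],
    [mul_richardsonr]).  Hence [x] commutes with [R] exactly when
      [x (i^+) j = x i (j^-)]  for all [i] and [j],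
    a missing neighbour making its side zero.

    Reading this equation at [(a^-, b)] puts the nonzero entry [x a b] on the
    left, so the right-hand side cannot vanish for want of [b^-]: this is (1).
    Reading it at [(a, b^+)] puts [x a b] on the right and gives (2).  Finally,
    [R * e_(a,b)] has a nonzero entry only if some dot has [a] as successor, and
    [e_(a,b) * R] only if some dot has [b] as predecessor; when [a^-] and [b^+]
    are both missing, [e_(a,b)] thus commutes with [R], which gives (3). *)

Section LineDiagram.

Variables (n : nat) (d : seq nat).
Implicit Types i j : 'I_n.+1.

Lemma dot_eq i j : drow d i = drow d j -> dcol d i = dcol d j -> i = j.
Proof.
rewrite /drow /dcol => eq_row eq_col; apply/val_inj => /=.
by rewrite -(reshape_indexK d i) -(reshape_indexK d j) eq_row eq_col.
Qed.

(** Labels increase from one column to the next, so the condition [i < j] in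
    the sum defining the Richardson element is automatic. *)
Lemma hline_ltn i j : hline d i j -> (i < j)%N.
Proof.
by case/and3P => _ lt_col _; rewrite ltnNge (reshape_leq d) negb_or -leqNgt ltnW //=
  eq_sym (ltn_eqF lt_col).
Qed.

(** Of two candidate neighbours on the same side, the one in the nearer column
    would lie strictly between the ends of the other line. *)
Lemma hline_succ_uniq i j1 j2 : hline d i j1 -> hline d i j2 -> j1 = j2.
Proof.
case/and3P=> /eqP row1 lt1 /forallP gap1 /and3P[/eqP row2 lt2 /forallP gap2].
have := gap1 j2; have := gap2 j1.
rewrite -row1 -row2 eqxx /= lt1 lt2 /= -!leqNgt => le21 le12.
apply: dot_eq; first by rewrite -row1 -row2.
by apply/eqP; rewrite eqn_leq le12 le21.
Qed.

Lemma hline_pred_uniq i1 i2 j : hline d i1 j -> hline d i2 j -> i1 = i2.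
Proof.
case/and3P=> /eqP row1 lt1 /forallP gap1 /and3P[/eqP row2 lt2 /forallP gap2].
have := gap1 i2; have := gap2 i1.
rewrite row1 row2 eqxx /= lt1 lt2 !andbT -!leqNgt => le12 le21.
apply: dot_eq; first by rewrite row1 row2.
by apply/eqP; rewrite eqn_leq le12 le21.
Qed.

Lemma hsucc_hline i j : (hsucc d i == Some j) = hline d i j.
Proof.
rewrite /hsucc; case: pickP => [j' line_ij'|->//].
apply/eqP/idP => [[<-]//|line_ij]; congr Some.
exact: hline_succ_uniq line_ij' line_ij.
Qed.

Lemma hpred_hline i j : (hpred d j == Some i) = hline d i j.
Proof.
rewrite /hpred; case: pickP => [i' line_i'j|->//].
apply/eqP/idP => [[<-]//|line_ij]; congr Some.
exact: hline_pred_uniq line_i'j line_ij.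
Qed.

Lemma hsucc_hpred i j : (hsucc d i == Some j) = (hpred d j == Some i).
Proof. by rewrite hsucc_hline hpred_hline. Qed.

End LineDiagram.

Lemma sum_delta_mxE (R : pzSemiRingType) m n (P : 'I_m -> 'I_n -> bool)
    (f : 'I_m -> 'I_n -> R) i j :
  (\sum_i \sum_(j | P i j) f i j *: delta_mx i j) i j =
  if P i j then f i j else 0.
Proof.
pose A := \matrix_(i, j) if P i j then f i j else 0.
suff <- : A = \sum_i \sum_(j | P i j) f i j *: delta_mx i j by rewrite mxE.
rewrite [LHS]matrix_sum_delta; apply: eq_bigr => i' _.
rewrite [RHS]big_mkcond; apply: eq_bigr => j' _.
by rewrite mxE; case: (P i' j'); rewrite ?scale0r.
Qed.

Section Richardson.

Variables (K : fieldType) (n : nat) (d : seq nat).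
Implicit Types (A : 'M[K]_n.+1) (i j : 'I_n.+1).

Lemma richardsonE i j : richardson K n d i j = (hline d i j)%:R.
Proof.
have -> : richardson K n d =
    \sum_i \sum_(j | hline d i j && (i < j)%N) 1 *: delta_mx i j.
  by apply: eq_bigr => i' _; apply: eq_bigr => j' _; rewrite scale1r.
rewrite (sum_delta_mxE (fun i j => hline d i j && (i < j)%N)).
by case: (boolP (hline d i j)) => [/hline_ltn ->|].
Qed.

Lemma mul_richardsonl A i j :
  (richardson K n d *m A) i j = oapp (fun i' => A i' j) 0 (hsucc d i).
Proof.
rewrite mxE; case def_i': (hsucc d i) => [i'|] /=.
  rewrite (bigD1 i') //= big1 => [|i2 ne_i2].
    by rewrite richardsonE -hsucc_hline def_i' eqxx mul1r addr0.
  rewrite richardsonE -hsucc_hline def_i'.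
  by rewrite (inj_eq Some_inj) eq_sym (negbTE ne_i2) mul0r.
by rewrite big1 // => i2 _; rewrite richardsonE -hsucc_hline def_i' mul0r.
Qed.

Lemma mul_richardsonr A i j :
  (A *m richardson K n d) i j = oapp (A i) 0 (hpred d j).
Proof.
rewrite mxE; case def_j': (hpred d j) => [j'|] /=.
  rewrite (bigD1 j') //= big1 => [|j2 ne_j2].
    by rewrite richardsonE -hpred_hline def_j' eqxx mulr1 addr0.
  rewrite richardsonE -hpred_hline def_j'.
  by rewrite (inj_eq Some_inj) eq_sym (negbTE ne_j2) mulr0.
by rewrite big1 // => j2 _; rewrite richardsonE -hpred_hline def_j' mulr0.
Qed.

Lemma richardson_comm_entries A :
  lie_bracket (richardson K n d) A = 0 ->
  forall i j, oapp (fun i' => A i' j) 0 (hsucc d i) = oapp (A i) 0 (hpred d j).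
Proof.
move=> /eqP; rewrite subr_eq0 => /eqP commA i j.
by rewrite -mul_richardsonl -mul_richardsonr commA.
Qed.

Lemma richardson_comm_delta a b :
  hpred d a = None -> hsucc d b = None ->
  lie_bracket (richardson K n d) (delta_mx a b) = 0.
Proof.
move=> no_pred_a no_succ_b; apply/eqP; rewrite subr_eq0; apply/eqP/matrixP=> i j.
rewrite mul_richardsonl mul_richardsonr.
have -> : oapp (fun i' => delta_mx a b i' j) 0 (hsucc d i) = 0 :> K.
  case def_i': (hsucc d i) => [i'|] //=; rewrite mxE.
  case: eqP => // eq_i'; move/eqP: def_i'.
  by rewrite hsucc_hpred eq_i' no_pred_a.
case def_j': (hpred d j) => [j'|] //=; rewrite mxE.
case: (j' =P b) => [eq_j'|_]; last by rewrite andbF.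
by move/eqP: def_j'; rewrite -hsucc_hpred eq_j' no_succ_b.
Qed.

End Richardson.

Theorem lemma2p2 (K : closedFieldType) (p : nat) (hp : p \in [pchar K])
  (n : nat) (d : seq nat) (hd : dim_vector n d)
  (k : 'I_n.+1 -> 'I_n.+1 -> K) (x : 'M[K]_n.+1)
  (hx : x = \sum_i \sum_(j | nilrad_root d i j) k i j *: delta_mx i j)
  (a b : 'I_n.+1) (hab : nilrad_root d a b) (hk : k a b != 0)
  (hl : drow d a <> drow d b)
  (hcomm : lie_bracket (richardson K n d) x = 0) :
  (forall a' : 'I_n.+1, hpred d a = Some a' ->
     exists b' : 'I_n.+1,
       [/\ hpred d b = Some b', nilrad_root d a' b' & k a' b' = k a b]) /\
  (forall b' : 'I_n.+1, hsucc d b = Some b' ->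
     exists a' : 'I_n.+1,
       [/\ hsucc d a = Some a', nilrad_root d a' b' & k a' b' = k a b]) /\
  (hpred d a = None -> hsucc d b = None ->
     lie_bracket (richardson K n d) (x - k a b *: delta_mx a b) = 0).
Proof.
have xE i j : x i j = if nilrad_root d i j then k i j else 0.
  by rewrite hx (sum_delta_mxE (@nilrad_root n d)).
have xab : x a b = k a b by rewrite xE hab.
(* An entry of [x] equal to the nonzero [k a b] can only sit at a root of the
   nilradical, which is how membership in the nilradical is transported. *)
have entry i j : x i j = k a b -> nilrad_root d i j /\ k i j = k a b.
  by rewrite xE; case: ifP => // _ k0; rewrite -k0 eqxx in hk.
have eq_x := richardson_comm_entries hcomm.
split=> [a' /eqP|]; last split=> [b' /eqP|no_pred_a no_succ_b].
- rewrite -hsucc_hpred => /eqP succ_a'; have := eq_x a' b.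
  rewrite succ_a' /= xab; case: (hpred d b) => [b'|] /= eq_k.
    by have [root_ab' k_ab'] := entry _ _ (esym eq_k); exists b'.
  by rewrite eq_k eqxx in hk.
- rewrite hsucc_hpred => /eqP pred_b'; have := eq_x a b'.
  rewrite pred_b' /= xab; case: (hsucc d a) => [a'|] /= eq_k.
    by have [root_ab' k_ab'] := entry _ _ eq_k; exists a'.
  by rewrite -eq_k eqxx in hk.
have comm_ab := richardson_comm_delta K no_pred_a no_succ_b.
move/subr0_eq: hcomm => comm_x; move/subr0_eq: comm_ab => comm_ab.
rewrite /lie_bracket mulmxBr mulmxBl -scalemxAr -scalemxAl comm_x comm_ab.
exact: subrr.
Qed.
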